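(* Let $K$ be a field of characteristic $0$, $n\ge 2$, $P_0=K[x_1,\dots,x_n]$, $P=P_0[y_1,\dots,y_n]$ bigraded by $\deg x_i=(1,0)$, $\deg y_i=(0,1)$, and $P_+=(y_1,\dots,y_n)$. Let $r\ge 1$ be an integer and, for $\lambda\in K^n$, let $f_\lambda=\sum_{i=1}^n\lambda_i x_iy_i$. Then there exists a nonempty Zariski open subset $V\subset K^n$ such that for all $\lambda\in V$, with $R=P/f_\lambda^rP$, and all $j\le -n$, $$\dim_K\big(H^n_{P_+}(R)_j\big)_i=\begin{cases}\binom{n+i-1}{i}\binom{-j-1}{-n-j}, & 0\le i<r,\\[4pt] \binom{n+i-1}{i}\binom{-j-1}{-n-j}-\binom{n+i-r-1}{i-r}\binom{-j+r-1}{-n-j+r}, & r\le i\le -n-j+r-1.\end{cases}$$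
   Context: For a bigraded $P$-module $N$, $N_j=\bigoplus_i N_{(i,j)}$ is a graded $P_0$-module with $(N_j)_i=N_{(i,j)}$. $H^n_{P_+}(R)$ is local cohomology with its natural bigrading. *)

(* Defs.v *)
From HB Require Import structures.
From mathcomp Require Import all_boot all_order all_algebra ring_quotient.
From mathcomp Require Import boolp mpoly zify ring.

Set Implicit Arguments.
Unset Strict Implicit.
Unset Printing Implicit Defensive.

Import GRing.Theory.
Local Open Scope ring_scope.
Local Open Scope quotient_scope.

Section ModuleQuotient.
Variables (A : comNzRingType) (M : lmodType A) (W : submodClosed M).

(* [submodClosed] does not inherit from [zmodClosed], which [Quotient.quot]
   requires. *)
Definition zmod_of_submod : {pred M} := fun x => x \in W.
Fact zmod_of_submod_closed : zmod_closed zmod_of_submod.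
Proof.
split; first exact: rpred0.
by move=> x y Wx Wy; rewrite -scaleN1r; apply: rpredD => //; apply: rpredZ.
Qed.
HB.instance Definition _ :=
  GRing.isZmodClosed.Build M zmod_of_submod zmod_of_submod_closed.

Definition modquot := Quotient.quot zmod_of_submod.
HB.instance Definition _ := GRing.Zmodule.on modquot.

Definition modproj (x : M) : modquot := \pi_(Quotient.quot zmod_of_submod) x.
Definition modquot_scale (p : A) (u : modquot) : modquot :=
  modproj (p *: repr (u : Quotient.quot zmod_of_submod)).

Lemma modproj_eq x y : (modproj x == modproj y) = (x - y \in W).
Proof. by rewrite -Quotient.idealrBE. Qed.

Lemma modproj_surj (u : modquot) : exists x, u = modproj x.
Proof.
by exists (repr (u : Quotient.quot zmod_of_submod)); rewrite /modproj reprK.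
Qed.

Lemma modprojD x y : modproj (x + y) = modproj x + modproj y.
Proof. exact: raddfD. Qed.

Lemma modquot_scaleE p x : modquot_scale p (modproj x) = modproj (p *: x).
Proof.
apply/eqP; rewrite modproj_eq -scalerBr rpredZ // -modproj_eq.
by rewrite /modproj reprK.
Qed.

Fact modquot_scaleA a b u :
  modquot_scale a (modquot_scale b u) = modquot_scale (a * b) u.
Proof. by have [x ->] := modproj_surj u; rewrite !modquot_scaleE scalerA. Qed.
Fact modquot_scale1 : left_id 1 modquot_scale.
Proof.
by move=> u; have [x ->] := modproj_surj u; rewrite modquot_scaleE scale1r.
Qed.
Fact modquot_scaleDr : right_distributive modquot_scale +%R.
Proof.
move=> a u v; have [x ->] := modproj_surj u; have [y ->] := modproj_surj v.
by rewrite -modprojD !modquot_scaleE scalerDr modprojD.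
Qed.
Fact modquot_scaleDl u : {morph modquot_scale^~ u : a b / a + b}.
Proof.
move=> a b; have [x ->] := modproj_surj u.
by rewrite !modquot_scaleE scalerDl modprojD.
Qed.
HB.instance Definition _ := GRing.Zmodule_isLmodule.Build A modquot
  modquot_scaleA modquot_scale1 modquot_scaleDr modquot_scaleDl.

Lemma modprojZ p x : modproj (p *: x) = p *: modproj x.
Proof. by rewrite -modquot_scaleE. Qed.

End ModuleQuotient.
Arguments modproj {A M} W x.

Lemma scalerCA (A : comNzRingType) (M : lmodType A) (a b : A) (v : M) :
  a *: (b *: v) = b *: (a *: v).
Proof. by rewrite !scalerA mulrC. Qed.

Section Localization.
Variables (A : comNzRingType) (M : lmodType A) (s : A).

(* The pair [(m, k)] stands for the fraction [m / s ^ k]. *)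
Definition loc_eq (u v : M * nat) : bool :=
  `[< exists t : nat, s ^+ (t + v.2) *: u.1 = s ^+ (t + u.2) *: v.1 >].

Fact loc_eq_equiv : equiv_class_of loc_eq.
Proof.
split.
- by move=> u; apply/asboolP; exists 0%N.
- by move=> u v; apply/asboolP/asboolP => -[t H]; exists t.
- move=> v u w /asboolP[t1 H1] /asboolP[t2 H2]; apply/asboolP.
  exists (t1 + t2 + v.2)%N.
  rewrite (_ : t1 + t2 + v.2 + w.2 = (t2 + w.2) + (t1 + v.2))%N; last by lia.
  rewrite exprD -scalerA H1 scalerA -exprD addnC exprD -scalerA H2.
  by rewrite scalerA -exprD; congr (s ^+ _ *: _); lia.
Qed.

Canonical loc_eq_rel := EquivRelPack loc_eq_equiv.
Canonical loc_eq_enc := defaultEncModRel loc_eq.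

Definition loc := {eq_quot loc_eq}.
HB.instance Definition _ := Choice.on loc.

Definition frac (m : M) (k : nat) : loc := \pi_{eq_quot loc_eq} (m, k).
Definition num_den (x : loc) : M * nat := repr (x : {eq_quot loc_eq}).

Lemma frac_eq m k m' k' :
  frac m k = frac m' k' <-> exists t, s ^+ (t + k') *: m = s ^+ (t + k) *: m'.
Proof. by split=> [/eqmodP/asboolP|?]; last by apply/eqmodP/asboolP. Qed.

Lemma frac_num_den x : frac (num_den x).1 (num_den x).2 = x.
Proof. by rewrite /frac -surjective_pairing [LHS]reprK. Qed.

Lemma num_den_frac m k :
  exists t, s ^+ (t + k) *: (num_den (frac m k)).1
            = s ^+ (t + (num_den (frac m k)).2) *: m.
Proof. by apply/frac_eq; rewrite frac_num_den. Qed.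

Lemma loc_surj x : exists m k, x = frac m k.
Proof. by exists (num_den x).1, (num_den x).2; rewrite frac_num_den. Qed.

Definition loc_zero : loc := frac 0 0.
Definition loc_opp (x : loc) : loc := frac (- (num_den x).1) (num_den x).2.
Definition loc_scale (p : A) (x : loc) : loc :=
  frac (p *: (num_den x).1) (num_den x).2.
Definition loc_add (x y : loc) : loc :=
  frac (s ^+ (num_den y).2 *: (num_den x).1 + s ^+ (num_den x).2 *: (num_den y).1)
       ((num_den x).2 + (num_den y).2).

Lemma fracN m k : loc_opp (frac m k) = frac (- m) k.
Proof.
have [t H] := num_den_frac m k.
by apply/frac_eq; exists t; rewrite !scalerN H.
Qed.

Lemma fracZ p m k : loc_scale p (frac m k) = frac (p *: m) k.
Proof.
have [t H] := num_den_frac m k.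
by apply/frac_eq; exists t; rewrite scalerCA H scalerCA.
Qed.

Lemma fracD m k m' k' :
  loc_add (frac m k) (frac m' k') = frac (s ^+ k' *: m + s ^+ k *: m') (k + k').
Proof.
have [t H] := num_den_frac m k; have [t' H'] := num_den_frac m' k'.
rewrite /loc_add; move: (num_den (frac m k)) (num_den (frac m' k')) H H'.
move=> [n l] [n' l'] /= H H'; apply/frac_eq; exists (t + t')%N.
rewrite !scalerDr !scalerA -!exprD; congr (_ + _).
  rewrite (_ : t + t' + (k + k') + l' = (t' + k' + l') + (t + k))%N; last by lia.
  by rewrite exprD -scalerA H scalerA -exprD; congr (s ^+ _ *: _); lia.
rewrite (_ : t + t' + (k + k') + l = (t + k + l) + (t' + k'))%N; last by lia.
by rewrite exprD -scalerA H' scalerA -exprD; congr (s ^+ _ *: _); lia.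
Qed.

Fact loc_addA : associative loc_add.
Proof.
move=> x y z; have [m [k ->]] := loc_surj x; have [m' [k' ->]] := loc_surj y.
have [m'' [k'' ->]] := loc_surj z; rewrite !fracD addnA; congr frac.
rewrite !scalerDr !scalerA -!exprD addrA.
by congr (_ *: _ + _ *: _ + _ *: _); congr (s ^+ _); lia.
Qed.
Fact loc_addC : commutative loc_add.
Proof.
move=> x y; have [m [k ->]] := loc_surj x; have [m' [k' ->]] := loc_surj y.
by rewrite !fracD addnC addrC.
Qed.
Fact loc_add0 : left_id loc_zero loc_add.
Proof.
move=> x; have [m [k ->]] := loc_surj x.
by rewrite fracD scaler0 add0r scale1r add0n.
Qed.
Fact loc_addN : left_inverse loc_zero loc_opp loc_add.
Proof.
move=> x; have [m [k ->]] := loc_surj x; rewrite fracN fracD scalerN addNr.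
by apply/frac_eq; exists 0%N; rewrite !scaler0.
Qed.
HB.instance Definition _ :=
  GRing.isZmodule.Build loc loc_addA loc_addC loc_add0 loc_addN.

Fact loc_scaleA a b x : loc_scale a (loc_scale b x) = loc_scale (a * b) x.
Proof. by have [m [k ->]] := loc_surj x; rewrite !fracZ scalerA. Qed.
Fact loc_scale1 : left_id 1 loc_scale.
Proof. by move=> x; have [m [k ->]] := loc_surj x; rewrite fracZ scale1r. Qed.
Fact loc_scaleDr : right_distributive loc_scale +%R.
Proof.
move=> a x y; have [m [k ->]] := loc_surj x; have [m' [k' ->]] := loc_surj y.
rewrite [frac m k + _]fracD !fracZ [RHS]fracD scalerDr !scalerA.
by congr frac; rewrite ![a * _]mulrC.
Qed.
Fact loc_scaleDl x : {morph loc_scale^~ x : a b / a + b}.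
Proof.
move=> a b; have [m [k ->]] := loc_surj x; rewrite !fracZ [RHS]fracD.
apply/frac_eq; exists 0%N; rewrite !add0n -scalerDr !scalerA -exprD -scalerDl.
by rewrite scalerA.
Qed.
HB.instance Definition _ := GRing.Zmodule_isLmodule.Build A loc
  loc_scaleA loc_scale1 loc_scaleDr loc_scaleDl.

End Localization.
Arguments frac {A M} s m k.

(* The localization map [M_s -> M_t], [m / s ^ k |-> (u ^ k *: m) / t ^ k];
   it is well defined when [t = s * u]. *)
Definition loc_map (A : comNzRingType) (M : lmodType A) (s t u : A)
    (x : loc M s) : loc M t :=
  frac t (u ^+ (num_den x).2 *: (num_den x).1) (num_den x).2.

Section LocalizationMap.
Variables (A : comNzRingType) (M : lmodType A) (s t u : A) (tE : t = s * u).

Lemma loc_mapE (m : M) k : loc_map t u (frac s m k) = frac t (u ^+ k *: m) k.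
Proof.
have [e H] := num_den_frac s m k.
rewrite /loc_map; move: (num_den (frac s m k)) H => [p l] /= H.
have tuE x y (v : M) :
    (s * u) ^+ (e + x) *: (u ^+ y *: v) = u ^+ (e + x + y) *: (s ^+ (e + x) *: v).
  by rewrite exprMn scalerA -mulrA -exprD mulrC -scalerA.
by apply/frac_eq; exists e; rewrite tE !tuE H; congr (u ^+ _ *: _); lia.
Qed.

Lemma loc_map_linear : linear (@loc_map A M s t u).
Proof.
move=> a x y; have [m [k ->]] := loc_surj x; have [m' [k' ->]] := loc_surj y.
rewrite [a *: frac _ _ _]fracZ [_ + _]fracD !loc_mapE.
rewrite [a *: frac _ _ _]fracZ [RHS]fracD; congr frac.
rewrite tE !exprMn scalerDr !scalerA !exprD.
by congr (_ *: _ + _ *: _); ring.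
Qed.

End LocalizationMap.

Section Cech.
Variables (A : comNzRingType) (M : lmodType A) (n : nat) (a : 'I_n -> A).

Definition cech_den (S : {set 'I_n}) : A := \prod_(i in S) a i.

(* Cochains of all degrees at once; those of degree [k] are supported on the
   sets of cardinality [k], see [cech_supp]. *)
Definition cochain : Type := forall S : {set 'I_n}, loc M (cech_den S).
HB.instance Definition _ := gen_eqMixin cochain.
HB.instance Definition _ := gen_choiceMixin cochain.

Fact cochain_addA : associative (fun (c c' : cochain) S => c S + c' S).
Proof. by move=> c c' c''; apply: functional_extensionality_dep => S; rewrite addrA. Qed.
Fact cochain_addC : commutative (fun (c c' : cochain) S => c S + c' S).
Proof. by move=> c c'; apply: functional_extensionality_dep => S; rewrite addrC. Qed.
Fact cochain_add0 : left_id (fun=> 0) (fun (c c' : cochain) S => c S + c' S).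
Proof. by move=> c; apply: functional_extensionality_dep => S; rewrite add0r. Qed.
Fact cochain_addN : left_inverse (fun=> 0) (fun (c : cochain) S => - c S)
  (fun (c c' : cochain) S => c S + c' S).
Proof. by move=> c; apply: functional_extensionality_dep => S; rewrite addNr. Qed.
HB.instance Definition _ := GRing.isZmodule.Build cochain
  cochain_addA cochain_addC cochain_add0 cochain_addN.

Definition cochain_scale (p : A) (c : cochain) : cochain := fun S => p *: c S.
Fact cochain_scaleA p q c :
  cochain_scale p (cochain_scale q c) = cochain_scale (p * q) c.
Proof. by apply: functional_extensionality_dep => S; rewrite /cochain_scale scalerA. Qed.
Fact cochain_scale1 : left_id 1 cochain_scale.
Proof.
by move=> c; apply: functional_extensionality_dep => S; rewrite /cochain_scale scale1r.
Qed.
Fact cochain_scaleDr : right_distributive cochain_scale +%R.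
Proof.
by move=> p c c'; apply: functional_extensionality_dep => S; rewrite /cochain_scale scalerDr.
Qed.
Fact cochain_scaleDl c : {morph cochain_scale^~ c : p q / p + q}.
Proof.
by move=> p q; apply: functional_extensionality_dep => S; rewrite /cochain_scale scalerDl.
Qed.
HB.instance Definition _ := GRing.Zmodule_isLmodule.Build A cochain
  cochain_scaleA cochain_scale1 cochain_scaleDr cochain_scaleDl.

Lemma cochain0E S : (0 : cochain) S = 0. Proof. by []. Qed.
Lemma cochainDE (c c' : cochain) S : (c + c') S = c S + c' S. Proof. by []. Qed.
Lemma cochainZE p (c : cochain) S : (p *: c) S = p *: c S. Proof. by []. Qed.

Definition cech_d (c : cochain) : cochain := fun T =>
  \sum_(i in T) (-1) ^+ #|[set j in T | (j < i)%N]|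
                *: loc_map (cech_den T) (a i) (c (T :\ i)).

Lemma cech_d_linear : linear cech_d.
Proof.
move=> p c c'; apply: functional_extensionality_dep => T.
rewrite cochainDE cochainZE scaler_sumr -big_split /=.
apply: eq_bigr => i Ti; rewrite cochainDE cochainZE loc_map_linear; last first.
  by rewrite /cech_den (big_setD1 i) //= mulrC.
by rewrite scalerDr !scalerA mulrC.
Qed.

Definition cech_supp (k : nat) (c : cochain) : Prop :=
  forall S : {set 'I_n}, #|S| != k -> c S = 0.

Definition cocycles (k : nat) : {pred cochain} :=
  fun c => `[< cech_supp k c /\ cech_d c = 0 >].

Fact cocycles_closed k : submod_closed (cocycles k).
Proof.
have d0 : cech_d 0 = 0.
  by have := cech_d_linear (-1) 0 0; rewrite scaleN1r oppr0 addr0 scaleN1r addNr.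
split; first by apply/asboolP.
move=> p c c' /asboolP[Hc dc] /asboolP[Hc' dc']; apply/asboolP; split.
  by move=> S hS; rewrite cochainDE cochainZE Hc // Hc' // scaler0 addr0.
by rewrite cech_d_linear dc dc' scaler0 addr0.
Qed.
HB.instance Definition _ k :=
  GRing.isSubmodClosed.Build A cochain (cocycles k) (cocycles_closed k).

Definition cocycle (k : nat) : Type := {c : cochain | c \in cocycles k}.
HB.instance Definition _ k := Choice.on (cocycle k).
HB.instance Definition _ k := SubChoice.on (cocycle k).
HB.instance Definition _ k := [SubChoice_isSubLmodule of cocycle k by <:].

(* The condition [#|S|.+1 != k] says that [b] has degree [k - 1], and that it
   vanishes when [k = 0]. *)
Definition coboundaries (k : nat) : {pred cocycle k} := fun z =>
  `[< exists b : cochain, (forall S : {set 'I_n}, #|S|.+1 != k -> b S = 0) /\ val z = cech_d b >].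

Arguments coboundaries k : clear implicits.

Fact coboundaries_closed k : submod_closed (coboundaries k).
Proof.
have d0 : cech_d 0 = 0.
  by have := cech_d_linear (-1) 0 0; rewrite scaleN1r oppr0 addr0 scaleN1r addNr.
split; first by apply/asboolP; exists 0; rewrite d0.
move=> p z z' /asboolP[b [Hb zb]] /asboolP[b' [Hb' zb']]; apply/asboolP.
exists (p *: b + b'); split.
  by move=> S hS; rewrite cochainDE cochainZE Hb // Hb' // scaler0 addr0.
by rewrite cech_d_linear -zb -zb'.
Qed.
HB.instance Definition _ k :=
  GRing.isSubmodClosed.Build A (cocycle k) (coboundaries k) (coboundaries_closed k).

(* [H^k_I(M)] for the ideal [I] generated by the family [a]. *)
Definition local_cohomology (k : nat) : lmodType A := modquot (coboundaries k).

(* [gr g x] means that [x : M] is homogeneous of degree [g], and [a i] is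
   homogeneous of degree [deg i]. *)
Variables (G : zmodType) (gr : G -> M -> Prop) (deg : 'I_n -> G).

(* [m / s ^ k] has degree [g] when [m] has degree [g + k * degree of s]. *)
Definition loc_gr (S : {set 'I_n}) (g : G) (x : loc M (cech_den S)) : Prop :=
  exists (m : M) (k : nat),
    gr (g + (\sum_(i in S) deg i) *+ k) m /\ x = frac (cech_den S) m k.

Definition local_cohomology_gr (k : nat) (g : G) (h : local_cohomology k) : Prop :=
  exists z : cocycle k,
    (forall S, loc_gr g (val z S)) /\ h = modproj (coboundaries k) z.

End Cech.
Arguments local_cohomology {A} M {n} a k.
Arguments local_cohomology_gr {A M n a G} gr deg k g h.

(* [N] is a module over a [K]-algebra, seen as a [K]-vector space by restriction
   of scalars; [U] is a subset of [N]. *)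
Definition has_dim (K : fieldType) (A : comAlgType K) (N : lmodType A)
    (U : N -> Prop) (d : nat) : Prop :=
  exists e : 'I_d -> N,
    (forall c : 'I_d -> K,
        \sum_i (c i)%:A *: e i = 0 -> forall i, c i = 0) /\
    (forall v : N, U v <-> exists c : 'I_d -> K, v = \sum_i (c i)%:A *: e i).

Section Hypersurface.
Variables (K : fieldType) (n : nat).

(* [P = K[x_1, ..., x_n, y_1, ..., y_n]], the first [n] variables being the
   [x_i] and the last [n] ones the [y_i]. *)
Definition bipoly : comAlgType K := {mpoly K[n + n]}.
Definition xvar (i : 'I_n) : bipoly := 'X_(lshift n i).
Definition yvar (i : 'I_n) : bipoly := 'X_(rshift n i).

Definition mnm_bideg (m : 'X_{1..n + n}) : int * int :=
  ((\sum_(i < n) m (lshift n i))%N%:Z, (\sum_(i < n) m (rshift n i))%N%:Z).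

Definition bipoly_gr (g : int * int) (p : bipoly) : Prop :=
  forall m, m \in msupp (p : {mpoly K[n + n]}) -> mnm_bideg m = g.

Definition f_lambda (l : 'I_n -> K) : bipoly :=
  \sum_(i < n) l i *: (xvar i * yvar i).

Definition principal (g : bipoly) : {pred bipoly^o} :=
  fun p => `[< exists q : bipoly, p = g * q >].

Fact principal_closed g : submod_closed (principal g).
Proof.
split; first by apply/asboolP; exists 0; rewrite mulr0.
move=> a p p' /asboolP[q ->] /asboolP[q' ->]; apply/asboolP.
by exists (a * q + q'); rewrite mulrDr mulrCA.
Qed.
HB.instance Definition _ g :=
  GRing.isSubmodClosed.Build bipoly bipoly^o (principal g) (principal_closed g).

Definition hypersurface (g : bipoly) : lmodType bipoly := modquot (principal g).

(* The bigrading induced on [P / gP]; [g] is meant to be bihomogeneous. *)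
Definition hypersurface_gr (g : bipoly) (d : int * int) (x : hypersurface g) : Prop :=
  exists p : bipoly, bipoly_gr d p /\ x = modproj (principal g) p.

(* The component [(H^k_{P_+}(P / gP)_j)_i] of bidegree [(i, j)], as a subset of
   [H^k_{P_+}(P / gP)]. *)
Definition lc_component (g : bipoly) (k : nat) (i j : int) :
    local_cohomology (hypersurface g) yvar k -> Prop :=
  local_cohomology_gr (@hypersurface_gr g) (fun=> (0, 1)) k (i, j).

(* Complements of zero loci of arbitrary families of polynomials. *)
Definition zariski_open (V : ('I_n -> K) -> Prop) : Prop :=
  exists E : {mpoly K[n]} -> Prop,
    forall l, V l <-> exists2 p, E p & p.@[l] != 0.

End Hypersurface.

(* Main.v *)
From HB Require Import structures.
Require Import Defs.
From mathcomp Require Import all_boot all_order all_algebra.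
From mathcomp Require Import boolp mpoly zify ring.

Set Implicit Arguments.
Unset Strict Implicit.
Unset Printing Implicit Defensive.

Import Order.TTheory GRing.Theory Num.Theory.
Local Open Scope ring_scope.

(** Why the theorem holds.

    The top local cohomology of a module [M] with respect to [n] elements [a_i]
    is computed by fractions [m / (a_1 ... a_n) ^ k] modulo those that do not
    need all of the [a_i] as denominators ([top_class_eq0]). For [M = P], with
    [a_i = y_i], this leaves the span of the monomials [x^a y^(-1-c)] with
    [c >= 0]. In characteristic [0], after division of [y^(-1-c)] by [c!], it
    becomes a second polynomial ring [K[x, z]], on which [y_i] acts as
    [d/dz_i]. Top local cohomology being right exact, [H^n(P / f^r P)] is the
    cokernel of [E^r], where [E = sum_i l_i x_i d/dz_i] is the action of
    [f_lambda]. The isomorphism is realized on numerators by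
    [inverse_of_num k], whose inverse up to the powers [y_i ^ k] is
    [num_of_inverse k]; the description of the cokernel is
    [num_class_eq0] together with [num_class_image].

    The component of bidegree [(i, j)] is the part of degree [i] in [x] and
    [c = - j - n] in [z] of that cokernel. Its dimension is the number of
    monomials of bidegree [(i, c)] minus the rank of [E^r] from bidegree
    [(i - r, c + r)]. For [i < r] the source is zero, hence the first formula.

    For [r <= i] the second formula amounts to the injectivity of [E^r]. When
    every [l_i] is nonzero, which defines the open set, [E] and
    [F = sum_i l_i^-1 z_i d/dx_i] form an [sl_2]-triple together with the
    operator that multiplies bidegree [(a, b)] by [a - b]. As in every locally
    finite representation of [sl_2] in characteristic [0], [E^s] is injective
    on the vectors of weight at most [- s] ([iter_raisex_inj]), and the bound on
    [i] puts the weight [(i - r) - (c + r)] in this range. *)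

(** * Top local cohomology of a module *)

Section Quotients.
Variables (A : comNzRingType) (M : lmodType A) (W : submodClosed M).

Lemma modproj0 : modproj W 0 = 0.
Proof. by rewrite -[0 in LHS](scale0r 0) modprojZ scale0r. Qed.

Lemma modproj_sum (I : Type) (l : seq I) (F : I -> M) :
  modproj W (\sum_(i <- l) F i) = \sum_(i <- l) modproj W (F i).
Proof. exact: (big_morph _ (@modprojD _ _ W) modproj0). Qed.

Lemma modproj_eq0 x : modproj W x = 0 <-> x \in W.
Proof. by rewrite -[x in x \in W]subr0 -modproj_eq modproj0; split=> /eqP. Qed.

End Quotients.

Section Fractions.
Variables (A : comNzRingType) (M : lmodType A) (s : A).

Lemma fracDZ p (m m' : M) k :
  Defs.frac s (p *: m + m') k = p *: Defs.frac s m k + Defs.frac s m' k.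
Proof.
apply/esym; rewrite [p *: Defs.frac _ _ _]fracZ [LHS]fracD; apply/frac_eq.
exists 0%N; rewrite !add0n -scalerDr !scalerA -!exprD.
by congr (s ^+ _ *: _); lia.
Qed.

Lemma frac0 k : Defs.frac s (0 : M) k = 0.
Proof. by apply/frac_eq; exists 0%N; rewrite !scaler0. Qed.

Lemma loc_map0 t u : t = s * u -> loc_map t u (0 : loc M s) = 0.
Proof.
move=> tE; rewrite -[in LHS](frac0 0) loc_mapE // scaler0.
by apply/frac_eq; exists 0%N; rewrite !scaler0.
Qed.

Lemma frac_scale_den (m : M) k t : Defs.frac s (s ^+ t *: m) (k + t) = Defs.frac s m k.
Proof.
apply/frac_eq; exists 0%N; rewrite scalerA -exprD.
by congr (s ^+ _ *: _); lia.
Qed.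

Lemma frac_sum (I : Type) (l : seq I) (m : I -> M) k :
  \sum_(i <- l) Defs.frac s (m i) k = Defs.frac s (\sum_(i <- l) m i) k.
Proof.
elim: l => [|i l IH]; first by rewrite !big_nil frac0.
by rewrite !big_cons IH -[m i in RHS]scale1r fracDZ scale1r.
Qed.

End Fractions.

Section TopCech.
Variables (A : comNzRingType) (M : lmodType A) (n : nat) (a : 'I_n -> A).
Local Notation full := [set: 'I_n].
Local Notation s := (cech_den a full).

Lemma cech_den_full i : s = cech_den a (full :\ i) * a i.
Proof. by rewrite /cech_den (big_setD1 i) ?inE //= mulrC. Qed.

(** There is no room above degree [n]. *)
Lemma cech_d_top (c : cochain M a) : cech_supp n c -> cech_d c = 0.
Proof.
move=> cn; apply: functional_extensionality_dep => T.
rewrite /cech_d big1 // => i Ti; rewrite cn ?loc_map0 ?scaler0 //.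
  by rewrite /cech_den (big_setD1 i) //= mulrC.
have := subset_leq_card (subsetT T); rewrite cardsT card_ord (cardsD1 i T) Ti.
by rewrite add1n => /ltn_eqF ->.
Qed.

Definition single_cochain (U : {set 'I_n}) (m : M) (k : nat) : cochain M a :=
  fun S => if S == U then Defs.frac (cech_den a S) m k else 0.

Lemma single_cochainP U p m m' k :
  single_cochain U (p *: m + m') k
  = p *: single_cochain U m k + single_cochain U m' k.
Proof.
apply: functional_extensionality_dep => S.
rewrite cochainDE cochainZE /single_cochain.
by case: eqP => _; rewrite ?fracDZ // scaler0 addr0.
Qed.

Lemma single_cochain_full_cocycle m k : single_cochain full m k \in cocycles n.
Proof.
have supp : cech_supp n (single_cochain full m k).
  move=> S hS; rewrite /single_cochain; have [E|//] := eqVneq S full.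
  by rewrite E cardsT card_ord eqxx in hS.
by apply/asboolP; split => //; exact: cech_d_top.
Qed.

Definition top_cocycle (m : M) (k : nat) : cocycle M a n :=
  Sub (single_cochain full m k) (single_cochain_full_cocycle m k).

(** A cochain of degree [n] is a single fraction, and it is automatically a
    cocycle, so that every class of degree [n] has this form. *)
Definition top_class (m : M) (k : nat) : local_cohomology M a n :=
  modproj (@coboundaries A M n a n) (top_cocycle m k).

Lemma top_cocycleP p m m' k :
  top_cocycle (p *: m + m') k = p *: top_cocycle m k + top_cocycle m' k.
Proof. exact/val_inj/single_cochainP. Qed.

Lemma top_classP p m m' k :
  top_class (p *: m + m') k = p *: top_class m k + top_class m' k.
Proof. by rewrite /top_class top_cocycleP modprojD modprojZ. Qed.

Lemma top_class0 k : top_class 0 k = 0.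
Proof. by have := top_classP (-1) 0 0 k; rewrite scaler0 addr0 scaleN1r addNr. Qed.

Lemma top_classZ p m k : top_class (p *: m) k = p *: top_class m k.
Proof. by have := top_classP p m 0 k; rewrite top_class0 !addr0. Qed.

Lemma top_classD m m' k : top_class (m + m') k = top_class m k + top_class m' k.
Proof. by have := top_classP 1 m m' k; rewrite !scale1r. Qed.

Lemma top_class_sum (I : Type) (l : seq I) (m : I -> M) k :
  top_class (\sum_(i <- l) m i) k = \sum_(i <- l) top_class (m i) k.
Proof.
elim: l => [|i l IH]; first by rewrite !big_nil top_class0.
by rewrite !big_cons top_classD IH.
Qed.

Lemma top_class_scale_den m k t : top_class (s ^+ t *: m) (k + t) = top_class m k.
Proof.
rewrite /top_class; congr modproj; apply/val_inj => /=.
apply: functional_extensionality_dep => S; rewrite /single_cochain.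
by case: eqP => // ->; rewrite frac_scale_den.
Qed.

Lemma cech_d_single i m k :
  cech_d (single_cochain (full :\ i) m k)
  = single_cochain full ((-1) ^+ #|[set j in full | (j < i)%N]| *: (a i ^+ k *: m)) k.
Proof.
apply: functional_extensionality_dep => T; rewrite /cech_d [RHS]/single_cochain.
have [->|TF] := eqVneq T full.
  rewrite (bigD1 i) ?inE //= [X in _ + X]big1 ?addr0 => [|i' /andP[_ ii']].
    rewrite /single_cochain eqxx loc_mapE ?(cech_den_full i) //.
    by rewrite [LHS]fracZ.
  rewrite /single_cochain; case: eqP => [/setP /(_ i')|_].
    by rewrite !inE ii' eqxx.
  by rewrite loc_map0 ?(cech_den_full i') // scaler0.
apply: big1 => i' Ti'; rewrite /single_cochain; case: eqP => [E|_].
  case/negP: TF; apply/eqP/setP => x; rewrite inE.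
  have := congr1 (fun X : {set 'I_n} => #|X|) E.
  have := subset_leq_card (subsetT T).
  have := cardsD1 i full; rewrite inE /= => e1.
  rewrite e1; have := cardsD1 i' T; rewrite Ti' => e2 le e3.
  have := eqEcard T full; rewrite subsetT /= e1 e2 e3 leqnn => /eqP e4.
  by rewrite e4 inE.
rewrite loc_map0 ?scaler0 //.
by rewrite /cech_den (big_setD1 i') //= mulrC.
Qed.

(** After cancellation of [a i ^+ k] the fraction has no [a i] in its
    denominator, so it comes from the cochains one degree below. *)
Lemma top_class_boundary i m k : top_class (a i ^+ k *: m) k = 0.
Proof.
apply/modproj_eq0/asboolP; set e := (-1) ^+ #|[set j in full | (j < i)%N]| : A.
exists (single_cochain (full :\ i) (e *: m) k); split.
  move=> S hS; rewrite /single_cochain; have [E|//] := eqVneq S (full :\ i).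
  have := cardsD1 i full; rewrite inE cardsT card_ord -E /= => e1.
  by rewrite [X in _ != X]e1 eqxx in hS.
rewrite cech_d_single /= -/e; congr single_cochain.
by rewrite Defs.scalerCA [RHS]scalerA -expr2 sqrr_sign scale1r.
Qed.

(** The top local cohomology is the direct limit of the quotients
    [M / (a_1 ^ k, ..., a_n ^ k) M] along multiplication by [a_1 ... a_n]; the
    statement is the vanishing criterion in such a limit. *)
Lemma top_class_eq0 m k :
  top_class m k = 0 <->
  exists t (q : 'I_n -> M), s ^+ t *: m = \sum_i a i ^+ (t + k) *: q i.
Proof.
split; last first.
  case=> t [q E]; rewrite -(top_class_scale_den m k t) E top_class_sum big1 //.
  by move=> i _; rewrite addnC top_class_boundary.
move/modproj_eq0/asboolP => [b [_ /(congr1 (fun c : cochain M a => c full))]].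
rewrite /= /single_cochain eqxx /cech_d.
(* The components of [b] are put over denominators of the common exponent
   [d]. *)
pose num i := (num_den (b (full :\ i))).1; pose den i := (num_den (b (full :\ i))).2.
have bE i : b (full :\ i) = Defs.frac _ (num i) (den i) by rewrite frac_num_den.
pose d := (\sum_i den i)%N.
have led i : (den i <= d)%N by rewrite /d (bigD1 i) //= leq_addr.
pose e (i : 'I_n) : A := (-1) ^+ #|[set j in full | (j < i)%N]|.
pose q i := e i *: (cech_den a (full :\ i) ^+ (d - den i) *: num i).
have -> : \sum_(i in full) (-1) ^+ #|[set j in full | (j < i)%N]|
    *: loc_map s (a i) (b (full :\ i)) = Defs.frac s (\sum_i a i ^+ d *: q i) d.
  rewrite -frac_sum; apply: eq_big => [i|i _]; first by rewrite inE.
  rewrite bE loc_mapE ?(cech_den_full i) // -(frac_scale_den _ _ _ (d - den i)).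
  rewrite subnKC ?led // [LHS]fracZ /q; congr (Defs.frac _ _ _).
  rewrite -/(e i) exprMn [RHS]Defs.scalerCA; congr (_ *: _); rewrite !scalerA.
  rewrite -mulrA -exprD subnK ?led //; congr (_ *: _); exact: mulrC.
case/frac_eq => t E; exists (t + d)%N.
exists (fun i => cech_den a (full :\ i) ^+ (t + k) *: q i).
rewrite E scaler_sumr; apply: eq_bigr => i _; move: (q i) => w.
rewrite !scalerA; congr (_ *: _); rewrite (cech_den_full i) exprMn.
by rewrite -mulrA -exprD mulrC; congr (_ ^+ _ * _); lia.
Qed.

Variables (G : zmodType) (gr : G -> M -> Prop) (deg : 'I_n -> G).
Hypothesis gr0 : forall g, gr g 0.

Lemma top_class_gr g (h : local_cohomology M a n) :
  local_cohomology_gr gr deg n g h <->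
  exists m k, gr (g + (\sum_i deg i) *+ k) m /\ h = top_class m k.
Proof.
have sumT : \sum_(i in full) deg i = \sum_i deg i.
  by apply: eq_bigl => i; rewrite inE.
split=> [[z [zg ->]]|[m [k [mg ->]]]].
  have [m [k [mg E]]] := zg full; exists m, k; split; first by rewrite -sumT.
  congr modproj; apply/val_inj/functional_extensionality_dep => S /=.
  rewrite /single_cochain; have [->|SF] := eqVneq S full; first exact: E.
  have /asboolP[supp _] := valP z; apply: supp.
  apply: contraNneq SF => e; rewrite eqEcard subsetT cardsT card_ord e.
  by rewrite leqnn.
exists (top_cocycle m k); split=> // S /=; rewrite /single_cochain.
have [->|SF] := eqVneq S full; last by exists 0, 0%N; rewrite frac0.
by exists m, k; rewrite sumT.
Qed.

End TopCech.

(** * Linear maps given on monomials *)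

Section MonomialMaps.
Variables (K : fieldType) (N : nat) (V : lmodType K).

Definition mlin (f : 'X_{1..N} -> V) (p : {mpoly K[N]}) : V :=
  \sum_(m <- msupp p) p@_m *: f m.

Lemma mlinwE f p k : (msize p <= k)%N ->
  mlin f p = \sum_(m : 'X_{1..N < k}) p@_m *: f m.
Proof.
move=> le_pk; pose I : subFinType _ := 'X_{1..N < k}.
rewrite /mlin (ssrcomplements.big_mksub I) ?msupp_uniq //=; last first.
  by move=> x /msize_mdeg_lt /leq_trans; apply.
by rewrite big_rmcond //= => m /memN_msupp_eq0 ->; rewrite scale0r.
Qed.

Fact mlin_is_linear f : linear (mlin f).
Proof.
move=> c p q; pose k := maxn (msize p) (maxn (msize q) (msize (c *: p + q))).
rewrite !(@mlinwE _ _ k) ?leq_max ?leqnn ?orbT // scaler_sumr -big_split /=.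
by apply: eq_bigr => m _; rewrite mcoeffD mcoeffZ scalerDl scalerA.
Qed.
HB.instance Definition _ f :=
  GRing.isLinear.Build K {mpoly K[N]} V *:%R (mlin f) (mlin_is_linear f).

Lemma mlinX f m : mlin f 'X_[m] = f m.
Proof. by rewrite /mlin msuppX big_seq1 mcoeffX eqxx scale1r. Qed.

End MonomialMaps.

Section Polarization.
Variables (K : fieldType) (N n : nat) (c : 'I_n -> K) (s t : 'I_n -> 'I_N).

Definition polar (p : {mpoly K[N]}) : {mpoly K[N]} :=
  \sum_i c i *: ('X_(s i) * p^`M(t i)).

Fact polar_is_linear : linear polar.
Proof.
move=> a p q; rewrite /polar scaler_sumr -big_split; apply: eq_bigr => i _ /=.
by rewrite linearP mulrDr -scalerAr scalerDr !scalerA mulrC.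
Qed.
HB.instance Definition _ :=
  GRing.isLinear.Build K {mpoly K[N]} {mpoly K[N]} *:%R polar polar_is_linear.

Lemma polarX m : polar 'X_[m] =
  \sum_i (c i * (m (t i))%:R) *: 'X_[U_(s i) + (m - U_(t i))].
Proof.
apply: eq_bigr => i _; rewrite mderivX -scalerAr scalerA.
by rewrite mpolyXD.
Qed.

End Polarization.

(** * Bihomogeneous polynomials *)

Section Bidegree.
Variables (K : fieldType) (n : nat).
Implicit Types (p q v : {mpoly K[n + n]}) (m : 'X_{1..n + n}).

(** The first [n] variables are the [x_i]; the last [n] are the [y_i], or the
    [z_i] dual to them. *)
Definition degx m := (\sum_(i < n) m (lshift n i))%N.
Definition degz m := (\sum_(i < n) m (rshift n i))%N.

Definition bipart (a b : nat) : {mpoly K[n + n]} -> {mpoly K[n + n]} :=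
  mlin (fun m => if (degx m == a) && (degz m == b) then 'X_[m] else 0).
HB.instance Definition _ a b := GRing.isLinear.Build K {mpoly K[n + n]}
  {mpoly K[n + n]} *:%R (bipart a b) (mlin_is_linear _).

Lemma bipartX a b m :
  bipart a b 'X_[m] = if (degx m == a) && (degz m == b) then 'X_[m] else 0.
Proof. exact: mlinX. Qed.

(** The zero polynomial is bihomogeneous of every bidegree. *)
Definition bihom a b p := bipart a b p = p.

Lemma mcoeff_bipart a b p m :
  (bipart a b p)@_m = if (degx m == a) && (degz m == b) then p@_m else 0.
Proof.
elim/mpolyind: p => [|c m' p _ _ IH]; first by rewrite linear0 mcoeff0 if_same.
rewrite linearP /= mcoeffD IH mcoeffZ bipartX mcoeffD mcoeffZ mcoeffX.
have [->|ne] := eqVneq m' m.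
  by case: ifP => _; rewrite ?mcoeffX ?eqxx ?mcoeff0 ?mulr0 ?add0r.
case: ifP => _; last by rewrite mcoeff0; case: ifP => _; rewrite ?mulr0 ?add0r.
by rewrite mcoeffX (negbTE ne); case: ifP => _; rewrite ?mulr0 ?add0r.
Qed.

Lemma bihomP a b p :
  bihom a b p <-> forall m, m \in msupp p -> degx m = a /\ degz m = b.
Proof.
split=> [h m|h].
  rewrite mcoeff_msupp -h mcoeff_bipart.
  by case: ifP => [/andP[/eqP -> /eqP ->]|_ /eqP].
apply/mpolyP => m; rewrite mcoeff_bipart; case: ifP => // ne.
apply/esym/eqP; rewrite mcoeff_eq0; apply: contraFN ne => /h [-> ->].
by rewrite !eqxx.
Qed.

Lemma degxD m m' : degx (m + m') = (degx m + degx m')%N.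
Proof. by rewrite -big_split; apply: eq_bigr => i _; rewrite mnmDE. Qed.
Lemma degzD m m' : degz (m + m') = (degz m + degz m')%N.
Proof. by rewrite -big_split; apply: eq_bigr => i _; rewrite mnmDE. Qed.

Lemma degxUx i : degx U_(lshift n i) = 1%N.
Proof.
rewrite /degx (bigD1 i) //= big1 ?mnmE ?eqxx // => j ji.
by rewrite mnmE (inj_eq (@lshift_inj _ _)) eq_sym (negbTE ji).
Qed.
Lemma degxUz i : degx U_(rshift n i) = 0%N.
Proof. by rewrite /degx big1 // => j _; rewrite mnmE eq_rlshift. Qed.
Lemma degzUx i : degz U_(lshift n i) = 0%N.
Proof. by rewrite /degz big1 // => j _; rewrite mnmE eq_lrshift. Qed.
Lemma degzUz i : degz U_(rshift n i) = 1%N.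
Proof.
rewrite /degz (bigD1 i) //= big1 ?mnmE ?eqxx // => j ji.
by rewrite mnmE (inj_eq (@rshift_inj _ _)) eq_sym (negbTE ji).
Qed.

Lemma mnm_pred_split m (j : 'I_(n + n)) : m j != 0%N ->
  exists m', m = (U_(j) + m')%MM.
Proof.
move=> mj; exists (m - U_(j))%MM; rewrite addmC submK //.
by apply/mnm_lepP => i; rewrite mnmE; case: eqP => [<-|]; rewrite ?lt0n.
Qed.

Variable l : 'I_n -> K.

(** The two nilpotent generators of [sl_2]: [raisex] is the action of
    [f_lambda] on inverse polynomials, and its partner [raisez] carries the
    inverse coefficients, which cancel in the commutator. *)
Definition raisex := polar l (@lshift n n) (@rshift n n).
Definition raisez := polar (fun i => (l i)^-1) (@rshift n n) (@lshift n n).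
HB.instance Definition _ := GRing.isLinear.Build K {mpoly K[n + n]}
  {mpoly K[n + n]} *:%R raisex (polar_is_linear _ _ _).
HB.instance Definition _ := GRing.isLinear.Build K {mpoly K[n + n]}
  {mpoly K[n + n]} *:%R raisez (polar_is_linear _ _ _).

Lemma bipart_raisex a b p : bipart a.+1 b (raisex p) = raisex (bipart a b.+1 p).
Proof.
elim/mpolyind: p => [|c m p _ _ IH]; first by rewrite !linear0.
rewrite !linearP /= IH bipartX; congr (_ *: _ + _); rewrite [raisex _]polarX linear_sum.
case: ifP => h; rewrite ?linear0 ?[raisex _]polarX; first apply: eq_bigr; last apply: big1.
all: move=> i _; rewrite linearZ /= bipartX.
all: have [m0|/mnm_pred_split[m' E]] := eqVneq (m (rshift n i)) 0%N;
  first by rewrite m0 mulr0 !scale0r.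
all: rewrite E [(U_(_) + m')%MM]addmC addmK; move: h; rewrite E !(degxD, degzD).
all: rewrite degxUx degxUz degzUx degzUz !add0n !add1n !eqSS => -> //.
by rewrite scaler0.
Qed.

Lemma bipart0_raisex b p : bipart 0 b (raisex p) = 0.
Proof.
elim/mpolyind: p => [|c m p _ _ IH]; first by rewrite !linear0.
rewrite !linearP /= IH addr0 [raisex _]polarX [bipart _ _ _]linear_sum big1 ?scaler0 // => i _.
by rewrite linearZ /= bipartX degxD degxUx scaler0.
Qed.

Lemma bipart_raisez a b p : bipart a b.+1 (raisez p) = raisez (bipart a.+1 b p).
Proof.
elim/mpolyind: p => [|c m p _ _ IH]; first by rewrite !linear0.
rewrite !linearP /= IH bipartX; congr (_ *: _ + _); rewrite [raisez _]polarX linear_sum.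
case: ifP => h; rewrite ?linear0 ?[raisez _]polarX; first apply: eq_bigr; last apply: big1.
all: move=> i _; rewrite linearZ /= bipartX.
all: have [m0|/mnm_pred_split[m' E]] := eqVneq (m (lshift n i)) 0%N;
  first by rewrite m0 mulr0 !scale0r.
all: rewrite E [(U_(_) + m')%MM]addmC addmK; move: h; rewrite E !(degxD, degzD).
all: rewrite degxUx degxUz degzUx degzUz !add0n !add1n !eqSS => -> //.
by rewrite scaler0.
Qed.

Lemma raisez_bipart0 b p : raisez (bipart 0 b p) = 0.
Proof.
elim/mpolyind: p => [|c m p _ _ IH]; first by rewrite !linear0.
rewrite !linearP /= IH addr0 bipartX; case: ifP; last by rewrite linear0 scaler0.
case/andP=> /eqP m0 _; rewrite [raisez _]polarX big1 ?scaler0 // => i _.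
move/eqP: m0; rewrite sum_nat_eq0 => /forallP /(_ i) /eqP ->.
by rewrite mulr0 scale0r.
Qed.

Lemma bipart_iter_raisex r a b p :
  bipart (a + r) b (iter r raisex p) = iter r raisex (bipart a (b + r) p).
Proof.
elim: r a b => [|r IH] a b; first by rewrite !addn0.
by rewrite iterS addnS bipart_raisex IH addSnnS.
Qed.

Lemma bipart_iter_raisex_lt r a b p : (a < r)%N ->
  bipart a b (iter r raisex p) = 0.
Proof.
elim: r a b => // r IH [|a] b; rewrite iterS ?bipart0_raisex // ltnS => /IH e.
by rewrite bipart_raisex e linear0.
Qed.

Lemma iter_raisexP r c p q :
  iter r raisex (c *: p + q) = c *: iter r raisex p + iter r raisex q.
Proof. by elim: r => // r IH; rewrite !iterS IH linearP. Qed.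

Lemma iter_raisex0 r : iter r raisex 0 = 0.
Proof. by elim: r => // r IH; rewrite iterS IH linear0. Qed.

Lemma bihom_iter_raisex r a b p :
  bihom a (b + r) p -> bihom (a + r) b (iter r raisex p).
Proof. by rewrite /bihom bipart_iter_raisex => ->. Qed.

(** * Injectivity of the powers of [raisex] *)

Hypothesis l0 : forall i, l i != 0.

Lemma euler_bihom a b p : bihom a b p ->
  \sum_i 'X_(lshift n i) * p^`M(lshift n i) = a%:R *: p /\
  \sum_i 'X_(rshift n i) * p^`M(rshift n i) = b%:R *: p.
Proof.
move=> <-; elim/mpolyind: p => [|c m p _ _ [IHx IHz]].
  by rewrite linear0; split; rewrite scaler0 big1 // => i _; rewrite mderiv0 mulr0.
have key (j : 'I_n -> 'I_(n + n)) k (q q' : {mpoly K[n + n]}) :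
   \sum_i 'X_(j i) * q^`M(j i) = k%:R *: q -> 
   \sum_i 'X_(j i) * q'^`M(j i) = k%:R *: q' -> 
   \sum_i 'X_(j i) * (c *: q + q')^`M(j i) = k%:R *: (c *: q + q').
  move=> h h'; rewrite scalerDr -h' Defs.scalerCA -h scaler_sumr -big_split.
  by apply: eq_bigr => i _ /=; rewrite linearP mulrDr -scalerAr.
have mono (j : 'I_n -> 'I_(n + n)) : \sum_i 'X_(j i) * ('X_[m])^`M(j i)
    = (\sum_i m (j i))%N%:R *: 'X_[m] :> {mpoly K[n + n]}.
  rewrite natr_sum scaler_suml; apply: eq_bigr => i _; rewrite mderivX -scalerAr.
  have [->|/mnm_pred_split[m' E]] := eqVneq (m (j i)) 0%N; first by rewrite !scale0r.
  by rewrite [in 'X_[_ - _]]E [(U_(_) + m')%MM]addmC addmK -mpolyXD -E.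
rewrite linearP /= bipartX; case: ifP => [/andP[/eqP ea /eqP eb]|_].
  subst a b; split; [apply: (key (@lshift n n)) IHx | apply: (key (@rshift n n)) IHz].
    exact: (mono (@lshift n n)).
  exact: (mono (@rshift n n)).
by rewrite scaler0 add0r.
Qed.

(** In the products [x_i d/dz_i z_j d/dx_j] and [z_j d/dx_j x_i d/dz_i] the
    second-order terms agree, and only [i = j] gives first-order terms. *)
Lemma raise_comm p : raisex (raisez p) =
  raisez (raisex p) + (\sum_i 'X_(lshift n i) * p^`M(lshift n i)
                       - \sum_i 'X_(rshift n i) * p^`M(rshift n i)).
Proof.
have UU (j : 'I_(n + n)) : (U_(j) - U_(j) = 0)%MM.
  by apply/mnmP => i; rewrite mnmBE subnn mnm0E.
have dxz i j : ('X_(rshift n j) : {mpoly K[n + n]})^`M(lshift n i) = 0.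
  by rewrite mderivX mnmE eq_rlshift scale0r.
have dzx i j : ('X_(lshift n j) : {mpoly K[n + n]})^`M(rshift n i) = 0.
  by rewrite mderivX mnmE eq_lrshift scale0r.
have dzz i j : ('X_(rshift n j) : {mpoly K[n + n]})^`M(rshift n i) = (i == j)%:R%:MP.
  rewrite mderivX mnmE (inj_eq (@rshift_inj _ _)) eq_sym -mul_mpolyC.
  case: eqP => [->|_]; last by rewrite !mul0r.
  by rewrite UU mpolyX0 mulr1.
have dxx i j : ('X_(lshift n j) : {mpoly K[n + n]})^`M(lshift n i) = (i == j)%:R%:MP.
  rewrite mderivX mnmE (inj_eq (@lshift_inj _ _)) eq_sym -mul_mpolyC.
  case: eqP => [->|_]; last by rewrite !mul0r.
  by rewrite UU mpolyX0 mulr1.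
have xzE : raisex (raisez p) = \sum_i 'X_(lshift n i) * p^`M(lshift n i)
  + \sum_i \sum_j (l i * (l j)^-1) *:
      ('X_(lshift n i) * 'X_(rshift n j) * p^`M(lshift n j)^`M(rshift n i)).
  rewrite -big_split; apply: eq_bigr => i _ /=; rewrite linear_sum mulr_sumr scaler_sumr.
  rewrite [X in X + _](_ : _ = \sum_j (i == j)%:R *: ('X_(lshift n i) * p^`M(lshift n i))).
    rewrite -big_split; apply: eq_bigr => j _ /=.
    rewrite linearZ /= mderivM dzz -scalerAr scalerA mulrDr scalerDr.
    congr (_ + _); last by rewrite mulrA.
    rewrite mul_mpolyC -scalerAr scalerA; have [->|_] := eqVneq i j.
      by rewrite divff ?mulr1.
    by rewrite mulr0 !scale0r.
  rewrite (bigD1 i) //= eqxx scale1r big1 ?addr0 // => j ji.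
  by rewrite eq_sym (negbTE ji) scale0r.
have zxE : raisez (raisex p) = \sum_i 'X_(rshift n i) * p^`M(rshift n i)
  + \sum_j \sum_i (l i * (l j)^-1) *:
      ('X_(lshift n i) * 'X_(rshift n j) * p^`M(lshift n j)^`M(rshift n i)).
  rewrite -big_split; apply: eq_bigr => i _ /=; rewrite linear_sum mulr_sumr scaler_sumr.
  rewrite [X in X + _](_ : _ = \sum_j (i == j)%:R *: ('X_(rshift n i) * p^`M(rshift n i))).
    rewrite -big_split; apply: eq_bigr => j _ /=.
    rewrite linearZ /= mderivM dxx -scalerAr scalerA mulrDr scalerDr; congr (_ + _).
      rewrite mul_mpolyC -scalerAr scalerA; have [->|_] := eqVneq i j.
        by rewrite mulVf ?mulr1.
      by rewrite mulr0 !scale0r.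
    by rewrite mulrA mderiv_comm ['X_(rshift n i) * _]mulrC [(l i)^-1 * _]mulrC.
  rewrite (bigD1 i) //= eqxx scale1r big1 ?addr0 // => j ji.
  by rewrite eq_sym (negbTE ji) scale0r.
rewrite xzE zxE exchange_big /=; ring.
Qed.

Lemma raisex_raisez_bihom a b p : bihom a b p ->
  raisex (raisez p) = raisez (raisex p) + (a%:R - b%:R) *: p.
Proof.
by case/euler_bihom => ex ez; rewrite raise_comm ex ez scalerBl.
Qed.

(** The commutator of [E^s] with [F], summed over the positions at which one
    factor [E] meets [F]; each crossing adds the weight of the vector reached,
    and the weight grows by [2] at each step. *)
Lemma iter_raisex_raisez s a b v : bihom a b v -> (s <= b.+1)%N ->
  iter s raisex (raisez v) = raisez (iter s raisex v)
    + (s%:R * (a%:R - b%:R + s%:R - 1)) *: iter s.-1 raisex v.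
Proof.
move=> hv; elim: s => [|s IH] sb; first by rewrite mul0r scale0r addr0.
have hs : bihom (a + s) (b - s) (iter s raisex v).
  by apply: bihom_iter_raisex; rewrite subnK.
rewrite iterS IH ?(ltnW sb) // linearD linearZ /= (raisex_raisez_bihom hs) -addrA.
congr (_ + _); have -> : (s%:R * (a%:R - b%:R + s%:R - 1)) *: raisex (iter s.-1 raisex v)
    = (s%:R * (a%:R - b%:R + s%:R - 1)) *: iter s raisex v.
  by case: s {IH sb hs} => [|s]; rewrite ?mul0r ?scale0r.
rewrite -scalerDl; congr (_ *: _); rewrite natrD natrB; last by rewrite -ltnS.
rewrite -[s.+1]addn1 natrD; ring.
Qed.

Hypothesis charK : [pchar K] =i pred0.

(** Induction on the degree [d] in [x], which [F] lowers, and then on [s]. If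
    [E^(s+1) v = 0] then [E^(s+2)] kills [F v] by the commutation formula, so
    [F v = 0] by induction on [d]. The same formula for [E^(s+1)] then reads
    [0 = (s + 1) (d - c + s) E^s v], whose coefficient is nonzero because
    [d + s < c]. *)
Lemma iter_raisex_inj d c s v :
  bihom d c v -> (d + s <= c)%N -> iter s raisex v = 0 -> v = 0.
Proof.
elim: d c s v => [|d IHd] c s v hv.
all: elim: s => // s IHs le E0; apply: IHs; first by lia.
all: have Fv0 : raisez v = 0; first last.
1,3: have sc : (s.+1 <= c.+1)%N by lia.
(* From [raisez v = 0] and [E^(s+1) v = 0] to [E^s v = 0]. *)
1,2: have := iter_raisex_raisez hv sc; rewrite Fv0 E0 iter_raisex0 linear0 add0r /=.
1,2: move/esym/eqP; rewrite scaler_eq0 mulf_eq0 => /orP[/orP[]|/eqP //].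
1,3: by rewrite (iffLR (pcharf0P _) charK).
- rewrite (_ : _ - 1 = - (c - s)%N%:R).
    by rewrite oppr_eq0 (iffLR (pcharf0P _) charK) => /eqP; lia.
  by rewrite natrB; [rewrite -[s.+1]addn1 natrD; ring|lia].
- rewrite (_ : _ - 1 = - (c - d.+1 - s)%N%:R).
    by rewrite oppr_eq0 (iffLR (pcharf0P _) charK) => /eqP; lia.
  by rewrite !natrB; [rewrite -[s.+1]addn1 natrD; ring|lia|lia].
- by rewrite -hv raisez_bipart0.
(* [raisez v = 0] in positive degree, by the induction hypothesis on [d]. *)
have hF : bihom d c.+1 (raisez v) by rewrite /bihom bipart_raisez hv.
apply: (IHd _ s.+2 _ hF); first by lia.
rewrite (iter_raisex_raisez hv); last by lia.
by rewrite -[s.+2.-1]/s.+1 [iter s.+2 _ v]iterS E0 !linear0 addr0.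
Qed.

End Bidegree.

(** * Numerators versus inverse polynomials *)

Section InversePolynomials.
Variables (K : fieldType) (n : nat).
Implicit Types (p q v : {mpoly K[n + n]}) (m : 'X_{1..n + n}) (i j : 'I_n).
Local Notation x := (@lshift n n).
Local Notation y := (@rshift n n).

(** A fraction [x^a y^b / (y_1 ... y_n)^k] is zero in the limit unless all
    entries of [b] are less than [k]; otherwise it is the inverse monomial
    [x^a y^(-1-c)] with [c = k - 1 - b], which is encoded as [x^a z^c]. *)
Definition box k m := [forall j, (m (y j) < k)%N].

Definition flip k m : 'X_{1..n + n} :=
  [multinom (if split i is inr _ then k.-1 - m i else m i)%N | i < n + n].

Definition zfact m := (\prod_j (m (y j))`!)%N.

(** The inverse polynomial of a fraction with denominator
    [(y_1 ... y_n)^k], in terms of divided powers [z^c / c!]. *)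
Definition inverse_of_num k : {mpoly K[n + n]} -> {mpoly K[n + n]} :=
  mlin (fun m => if box k m then (zfact (flip k m))%:R^-1 *: 'X_[flip k m] else 0).
HB.instance Definition _ k := GRing.isLinear.Build K {mpoly K[n + n]}
  {mpoly K[n + n]} *:%R (inverse_of_num k) (mlin_is_linear _).

(** A numerator over [(y_1 ... y_n)^k] for an inverse polynomial whose
    exponents are less than [k]. *)
Definition num_of_inverse k : {mpoly K[n + n]} -> {mpoly K[n + n]} :=
  mlin (fun m => if box k m then (zfact m)%:R *: 'X_[flip k m] else 0).
HB.instance Definition _ k := GRing.isLinear.Build K {mpoly K[n + n]}
  {mpoly K[n + n]} *:%R (num_of_inverse k) (mlin_is_linear _).

Lemma inverse_of_numX k m : inverse_of_num k 'X_[m] =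
  if box k m then (zfact (flip k m))%:R^-1 *: 'X_[flip k m] else 0.
Proof. exact: mlinX. Qed.

Lemma num_of_inverseX k m : num_of_inverse k 'X_[m] =
  if box k m then (zfact m)%:R *: 'X_[flip k m] else 0.
Proof. exact: mlinX. Qed.

Lemma flip_x k m i : flip k m (x i) = m (x i).
Proof. by rewrite mnmE (unsplitK (inl _ i)). Qed.
Lemma flip_y k m j : flip k m (y j) = (k.-1 - m (y j))%N.
Proof. by rewrite mnmE (unsplitK (inr _ j)). Qed.

Lemma mnm_xyP m m' :
  (forall i, m (x i) = m' (x i)) -> (forall i, m (y i) = m' (y i)) -> m = m'.
Proof.
move=> ex ey; apply/mnmP => i; rewrite -(splitK i).
by case: (split i) => j; [apply: ex | apply: ey].
Qed.

Lemma boxP k m : reflect (forall j, (m (y j) < k)%N) (box k m).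
Proof. exact: forallP. Qed.

Lemma box_flip k m : box k m -> box k (flip k m).
Proof.
by move=> /boxP h; apply/boxP => j; rewrite flip_y; have := h j; lia.
Qed.

Lemma flipK k m : box k m -> flip k (flip k m) = m.
Proof.
move=> /boxP h; apply: mnm_xyP => i; rewrite ?flip_x // !flip_y.
by have := h i; lia.
Qed.

Lemma degx_flip k m : degx (flip k m) = degx m.
Proof. by apply: eq_bigr => i _; rewrite flip_x. Qed.

Lemma degz_flip k m : box k m -> (degz (flip k m) + degz m = n * k.-1)%N.
Proof.
move=> /boxP h; rewrite /degz -big_split /= -[n in RHS]card_ord -sum_nat_const.
by apply: eq_bigr => j _; rewrite flip_y; have := h j; lia.
Qed.

Lemma box_addx k i m : box k (U_(x i) + m)%MM = box k m.
Proof. by apply: eq_forallb => j; rewrite mnmDE mnmE eq_lrshift. Qed.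

Lemma flip_addx k i m : flip k (U_(x i) + m) = (U_(x i) + flip k m)%MM.
Proof.
apply: mnm_xyP => j; rewrite ?(flip_x, flip_y, mnmDE) // mnmE eq_lrshift.
by rewrite !add0n.
Qed.

Lemma zfact_addx i m : zfact (U_(x i) + m) = zfact m.
Proof. by apply: eq_bigr => j _; rewrite mnmDE mnmE eq_lrshift. Qed.

Lemma inverse_of_numMx k i p :
  inverse_of_num k ('X_(x i) * p) = 'X_(x i) * inverse_of_num k p.
Proof.
elim/mpolyind: p => [|c m p _ _ IH]; first by rewrite mulr0 linear0 mulr0.
rewrite mulrDr -scalerAr !linearP /= IH mulrDr -scalerAr -mpolyXD.
rewrite !inverse_of_numX box_addx; case: ifP => _; last by rewrite mulr0.
by rewrite flip_addx zfact_addx -scalerAr mpolyXD.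
Qed.

Lemma zfact_addy j m : zfact (U_(y j) + m) = ((m (y j)).+1 * zfact m)%N.
Proof.
rewrite /zfact (bigD1 j) //= [in RHS](bigD1 j) //= mulnA -factS mnmDE mnmE eqxx.
congr (_ * _)%N; apply: eq_bigr => j' j'j; rewrite mnmDE mnmE.
by rewrite (inj_eq (@rshift_inj _ _)) eq_sym (negbTE j'j).
Qed.

Hypothesis charK : [pchar K] =i pred0.

Lemma natf_eq0 k : (k%:R == 0 :> K) = (k == 0%N).
Proof. exact: (iffLR (pcharf0P _) charK). Qed.

Lemma zfact_neq0 m : (zfact m)%:R != 0 :> K.
Proof.
rewrite natf_eq0 -lt0n; apply: prodn_gt0 => j; exact: fact_gt0.
Qed.

(** Multiplication by [y_j] lowers [c_j] by one, and the normalization by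
    factorials turns it into differentiation. When [m (y j) = k - 1] both sides
    vanish: [m] leaves the box on the left, and [c_j = 0] on the right. *)
Lemma inverse_of_numMy k j p :
  inverse_of_num k ('X_(y j) * p) = (inverse_of_num k p)^`M(y j).
Proof.
elim/mpolyind: p => [|c m p _ _ IH]; first by rewrite mulr0 linear0 mderiv0.
rewrite mulrDr -scalerAr !linearP /= IH -mpolyXD !inverse_of_numX; congr (_ *: _ + _).
have [/boxP bU|] := boolP (box k (U_(y j) + m)%MM).
  have b : box k m.
    by apply/boxP => i; apply: leq_trans (bU i); rewrite ltnS mnmDE leq_addl.
  have E : flip k m = (U_(y j) + flip k (U_(y j) + m))%MM.
    apply: mnm_xyP => i; first by rewrite mnmDE !flip_x mnmDE mnmE eq_rlshift.
    by rewrite mnmDE !flip_y; have := bU i; rewrite mnmDE; lia.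
  rewrite b E; move: (flip k (U_(y j) + m)) => m'.
  rewrite linearZ /= mderivX [(U_(y j) + m')%MM]addmC addmK addmC scalerA.
  rewrite zfact_addy mnmDE mnmE eqxx add1n natrM invfM; congr (_ *: _).
  by rewrite mulrAC mulVf ?mul1r // natf_eq0.
rewrite negb_forall => /existsP[i]; rewrite mnmDE -leqNgt => ki.
case: ifP => [/boxP b|_]; last by rewrite mderiv0.
have [ij|ne] := eqVneq i j; last first.
  move: ki; rewrite mnmE (inj_eq (@rshift_inj _ _)) eq_sym (negbTE ne) add0n.
  by rewrite leqNgt b.
rewrite linearZ /= mderivX flip_y (_ : (_ - _)%N = 0%N) ?scale0r ?scaler0 //.
by move: ki (b j); rewrite ij mnmE eqxx; lia.
Qed.

Lemma inverse_of_num_linear_form k (l : 'I_n -> K) r p :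
  inverse_of_num k ((\sum_i l i *: ('X_(x i) * 'X_(y i))) ^+ r * p)
  = iter r (raisex l) (inverse_of_num k p).
Proof.
elim: r => [|r IH]; first by rewrite mul1r.
rewrite exprS -mulrA iterS -IH; move: (_ ^+ r * p) => q.
rewrite mulr_suml linear_sum; apply: eq_bigr => i _.
by rewrite -scalerAl linearZ /= -mulrA inverse_of_numMx inverse_of_numMy.
Qed.

Lemma inverse_of_num_power k j p : inverse_of_num k ('X_(y j) ^+ k * p) = 0.
Proof.
elim/mpolyind: p => [|c m p _ _ IH]; first by rewrite mulr0 linear0.
rewrite mulrDr -scalerAr linearP /= IH addr0 mpolyXn -mpolyXD inverse_of_numX.
case: ifP => [/boxP /(_ j)|_]; last by rewrite scaler0.
by rewrite mnmDE mulmnE mnmE eqxx; lia.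
Qed.

Definition ymon : 'X_{1..n + n} := (\sum_j U_(y j))%MM.

Lemma ymon_x i : ymon (x i) = 0%N.
Proof. by rewrite mnm_sumE big1 // => j _; rewrite mnmE eq_rlshift. Qed.
Lemma ymon_y j : ymon (y j) = 1%N.
Proof.
rewrite mnm_sumE (bigD1 j) //= mnmE eqxx big1 // => i ij.
by rewrite mnmE (inj_eq (@rshift_inj _ _)) (negbTE ij).
Qed.

Lemma ymonE : \prod_j 'X_(y j) = 'X_[ymon] :> {mpoly K[n + n]}.
Proof.
by apply/esym; rewrite (big_morph (fun m => 'X_[m]) (@mpolyXD _ _) (@mpolyX0 _ _)).
Qed.

(** The value depends on the fraction only, not on its representation. *)
Lemma inverse_of_num_shift k t p :
  inverse_of_num (k + t) ((\prod_j 'X_(y j)) ^+ t * p) = inverse_of_num k p.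
Proof.
rewrite ymonE mpolyXn.
elim/mpolyind: p => [|c m p _ _ IH]; first by rewrite mulr0 !linear0.
rewrite mulrDr -scalerAr !linearP /= IH -mpolyXD !inverse_of_numX.
have -> : box (k + t) (ymon *+ t + m)%MM = box k m.
  apply: eq_forallb => j; rewrite mnmDE mulmnE ymon_y; lia.
have [/boxP b|//] := boolP (box k m).
have -> // : flip (k + t) (ymon *+ t + m) = flip k m.
apply: mnm_xyP => i; first by rewrite !flip_x mnmDE mulmnE ymon_x.
by rewrite !flip_y mnmDE mulmnE ymon_y; have := b i; lia.
Qed.

(** [inverse_of_num k] kills nothing but the ideal of the [y_j ^ k]. *)
Lemma num_of_inverseK k p : exists q : 'I_n -> {mpoly K[n + n]},
  p = num_of_inverse k (inverse_of_num k p) + \sum_j 'X_(y j) ^+ k * q j.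
Proof.
elim/mpolyind: p => [|c m p _ _ [q IH]].
  by exists (fun=> 0); rewrite !linear0 big1 ?addr0 // => j _; rewrite mulr0.
rewrite !linearP /= inverse_of_numX.
have [b|nb] := boolP (box k m).
  exists q; rewrite linearZ /= num_of_inverseX box_flip // flipK // [_^-1 *: _]scalerA.
  by rewrite mulVf ?zfact_neq0 // scale1r -addrA -IH.
move: (nb); rewrite negb_forall => /existsP[j]; rewrite -leqNgt => kj.
exists (fun i => q i + (i == j)%:R *: (c *: 'X_[m - U_(y j) *+ k])).
rewrite linear0 scaler0 add0r (eq_bigr (fun i => 'X_(y i) ^+ k * q i +
   (i == j)%:R *: ('X_(y i) ^+ k * (c *: 'X_[m - U_(y j) *+ k])))); last first.
  by move=> i _; rewrite mulrDr -scalerAr.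
rewrite big_split addrA -IH addrC /=; congr (_ + _).
rewrite (bigD1 j) //= eqxx big1 => [|i ij]; last by rewrite (negbTE ij) scale0r.
rewrite addr0 scale1r -scalerAr mpolyXn -mpolyXD addmC submK //.
apply/mnm_lepP => i; rewrite mulmnE mnmE; case: eqP => [<-|//].
by rewrite mul1n.
Qed.

Lemma inverse_of_num_eq0 k p : inverse_of_num k p = 0 ->
  exists q : 'I_n -> {mpoly K[n + n]}, p = \sum_j 'X_(y j) ^+ k * q j.
Proof.
move=> p0; have [q] := num_of_inverseK k p.
by rewrite p0 linear0 add0r; exists q.
Qed.

Lemma box_degz k m : (degz m < k)%N -> box k m.
Proof.
move=> h; apply/boxP => j; apply: leq_ltn_trans h.
by rewrite /degz (bigD1 j) //= leq_addr.
Qed.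

Lemma inverse_of_numK k a c v : bihom a c v -> (c < k)%N ->
  inverse_of_num k (num_of_inverse k v) = v.
Proof.
move=> <- ck; elim/mpolyind: v => [|e m v _ _ IH]; first by rewrite !linear0.
rewrite !linearP /= IH bipartX; congr (_ *: _ + _).
case: ifP => [/andP[_ /eqP mc]|_]; last by rewrite !linear0.
have b : box k m by apply: box_degz; rewrite mc.
rewrite num_of_inverseX b linearZ /= inverse_of_numX box_flip // flipK // scalerA.
by rewrite divff ?zfact_neq0 // scale1r.
Qed.

Lemma bihom_num_of_inverse k a c v : bihom a c v ->
  bihom a (n * k.-1 - c) (num_of_inverse k v).
Proof.
move=> <-; rewrite /bihom; elim/mpolyind: v => [|e m v _ _ IH].
  by rewrite !linear0.
rewrite !linearP /= IH bipartX; congr (_ *: _ + _).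
case: ifP => [/andP[/eqP mx /eqP mc]|_]; last by rewrite !linear0.
rewrite num_of_inverseX; case: ifP => [b|_]; last by rewrite linear0.
rewrite linearZ /= bipartX degx_flip mx eqxx -(degz_flip b) mc addnK.
by rewrite eqxx.
Qed.

Lemma bihom_inverse_of_num k a b c p : bihom a b p -> (b + c = n * k.-1)%N ->
  bihom a c (inverse_of_num k p).
Proof.
move=> <- bc; rewrite /bihom; elim/mpolyind: p => [|e m p _ _ IH].
  by rewrite !linear0.
rewrite !linearP /= IH bipartX; congr (_ *: _ + _).
case: ifP => [/andP[/eqP mx /eqP mc]|_]; last by rewrite !linear0.
rewrite inverse_of_numX; case: ifP => [bx|_]; last by rewrite linear0.
rewrite linearZ /= bipartX degx_flip mx eqxx (_ : degz _ = c) ?eqxx //.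
by have := degz_flip bx; lia.
Qed.

End InversePolynomials.

(** * Dimension of a quotient *)

(** A surjection from row vectors with kernel the row space of [B] is
    injective on a complement of that row space. *)
Lemma has_dim_image (K : fieldType) (A : comAlgType K) (N : lmodType A)
    (U : N -> Prop) (d d' : nat) (B : 'M[K]_(d', d)) (phi : 'rV[K]_d -> N) :
    (forall c u v, phi (c *: u + v) = c%:A *: phi u + phi v) ->
    (forall u, phi u = 0 <-> (u <= B)%MS) ->
    (forall h, U h <-> exists u, h = phi u) ->
  has_dim U (d - \rank B).
Proof.
move=> phiP phi0 Uphi; rewrite -mxrank_compl; set C := (B^C)%MS.
have phi00 : phi 0 = 0 by apply/phi0; apply: sub0mx.
have phiD u v : phi (u + v) = phi u + phi v.
  by have := phiP 1 u v; rewrite !scale1r.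
have phiZ c u : phi (c *: u) = c%:A *: phi u.
  by have := phiP c u 0; rewrite phi00 !addr0.
have phi_sum (c : 'I_(\rank C) -> K) :
    \sum_i (c i)%:A *: phi (row i (row_base C)) = phi ((\row_i c i) *m row_base C).
  rewrite mulmx_sum_row (big_morph _ phiD phi00).
  by apply: eq_bigr => i _; rewrite phiZ mxE.
exists (fun i => phi (row i (row_base C))); split=> [c|h].
  rewrite phi_sum => /phi0 sB i.
  have : ((\row_i c i) *m row_base C <= B :&: C)%MS.
    by rewrite sub_capmx sB (submx_trans (submxMl _ _)) // eq_row_base.
  rewrite capmx_compl submx0 => /eqP E.
  have := row_freeP (row_base_free C) => -[D WD].
  have := congr1 (mulmx^~ D) E; rewrite -mulmxA WD mulmx1 mul0mx.
  by move/rowP/(_ i); rewrite !mxE.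
rewrite Uphi; split=> [[u ->]|[c ->]]; last first.
  by exists ((\row_i c i) *m row_base C); rewrite phi_sum.
have /sub_addsmxP[[w w'] /= E] : (u <= B + C)%MS by rewrite submx_full // addsmx_compl_full.
have /submxP[z zE] : (w' *m C <= row_base C)%MS by rewrite eq_row_base submxMl.
exists (z 0); rewrite phi_sum E phiD (iffRL (phi0 _)) ?submxMl // add0r zE.
by congr (phi (_ *m _)); apply/rowP => i; rewrite mxE.
Qed.

(** * Counting monomials *)

Section Monomials.
Variables (K : fieldType) (N : nat).

Definition poly_of_row (L : seq 'X_{1..N}) (u : 'rV[K]_(size L)) : {mpoly K[N]} :=
  \sum_k u 0 k *: 'X_[tnth (in_tuple L) k].

Definition row_of_poly (L : seq 'X_{1..N}) (p : {mpoly K[N]}) : 'rV[K]_(size L) :=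
  \row_k p@_(tnth (in_tuple L) k).

Fact poly_of_row_is_linear L : linear (@poly_of_row L).
Proof.
move=> c u v; rewrite /poly_of_row scaler_sumr -big_split; apply: eq_bigr => k _ /=.
by rewrite !mxE scalerDl scalerA.
Qed.
HB.instance Definition _ L := GRing.isLinear.Build K 'rV[K]_(size L) {mpoly K[N]}
  *:%R (@poly_of_row L) (@poly_of_row_is_linear L).

Fact row_of_poly_is_linear L : linear (@row_of_poly L).
Proof. by move=> c p q; apply/rowP => k; rewrite !mxE mcoeffD mcoeffZ. Qed.
HB.instance Definition _ L := GRing.isLinear.Build K {mpoly K[N]} 'rV[K]_(size L)
  *:%R (@row_of_poly L) (@row_of_poly_is_linear L).

Variables (L : seq 'X_{1..N}) (uL : uniq L).

Lemma poly_of_rowK : cancel (@poly_of_row L) (@row_of_poly L).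
Proof.
move=> u; apply/rowP => k; rewrite mxE linear_sum (bigD1 k) //= big1 => [|k' k'k].
  by rewrite mcoeffZ mcoeffX eqxx mulr1 addr0.
rewrite mcoeffZ mcoeffX; case: eqP => [|_]; last by rewrite mulr0.
move/eqP; rewrite !(tnth_nth 0%MM) /= nth_uniq // => /eqP E.
by case/eqP: k'k; apply/val_inj.
Qed.

(** Together with [poly_of_rowK]: the polynomials supported on [L] have the
    coordinates [row_of_poly]. *)
Lemma row_of_polyK p : {subset msupp p <= L} -> poly_of_row (row_of_poly L p) = p.
Proof.
move=> sL; apply/mpolyP => m; rewrite linear_sum.
have [mL|mL] := boolP (m \in L).
  have ltm : (index m L < size L)%N by rewrite index_mem.
  have E : tnth (in_tuple L) (Ordinal ltm) = m by rewrite (tnth_nth 0%MM) /= nth_index.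
  rewrite (bigD1 (Ordinal ltm)) //= big1 => [|k km].
    by rewrite addr0 mcoeffZ mxE E mcoeffX eqxx mulr1.
  rewrite mcoeffZ mcoeffX; case: eqP => [e|_]; last by rewrite mulr0.
  case/eqP: km; apply/val_inj => /=.
  by rewrite -e (tnth_nth 0%MM) /= index_uniq.
rewrite big1 => [|k _] /=.
  by apply/esym/eqP; rewrite mcoeff_eq0; apply: contra mL; apply: sL.
rewrite mcoeffZ mcoeffX; case: eqP => [e|_]; last by rewrite mulr0.
by case/negP: mL; rewrite -e mem_tnth.
Qed.

End Monomials.

Section Bimonomials.
Variable n : nat.

(** Exponents of a monomial of bidegree [(a, b)] are at most [a] and [b], so
    such monomials are pairs of tuples of bounded integers, for which a count
    is known. *)
Definition mnm_of_tuples a b (w : n.-tuple 'I_a.+1 * n.-tuple 'I_b.+1) : 'X_{1..n + n} :=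
  [multinom (match split i with inl j => val (tnth w.1 j) | inr j => val (tnth w.2 j) end)
    | i < n + n].

Definition bimonomials a b : seq 'X_{1..n + n} :=
  [seq mnm_of_tuples w | w <- enum
    (setX [set t : n.-tuple 'I_a.+1 | (\sum_(i <- t) i)%N == a]
          [set t : n.-tuple 'I_b.+1 | (\sum_(i <- t) i)%N == b])].

Lemma mnm_of_tuples_x a b (w : n.-tuple 'I_a.+1 * n.-tuple 'I_b.+1) i :
  mnm_of_tuples w (lshift n i) = tnth w.1 i.
Proof. by rewrite mnmE (unsplitK (inl _ i)). Qed.
Lemma mnm_of_tuples_y a b (w : n.-tuple 'I_a.+1 * n.-tuple 'I_b.+1) i :
  mnm_of_tuples w (rshift n i) = tnth w.2 i.
Proof. by rewrite mnmE (unsplitK (inr _ i)). Qed.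

Lemma mnm_of_tuples_inj a b : injective (@mnm_of_tuples a b).
Proof.
move=> w w' /mnmP E; rewrite [w]surjective_pairing [w']surjective_pairing.
congr pair; apply: eq_from_tnth => i; apply/val_inj => /=.
  by rewrite -(mnm_of_tuples_x w) E mnm_of_tuples_x.
by rewrite -(mnm_of_tuples_y w) E mnm_of_tuples_y.
Qed.

Lemma bimonomials_uniq a b : uniq (bimonomials a b).
Proof. by rewrite map_inj_uniq ?enum_uniq //; apply: mnm_of_tuples_inj. Qed.

Lemma mem_bimonomials a b m :
  (m \in bimonomials a b) = (degx m == a) && (degz m == b).
Proof.
apply/mapP/andP => [[w]|[/eqP mx /eqP mz]].
  rewrite mem_enum !inE => /andP[/eqP w1 /eqP w2] ->; split; apply/eqP.
    rewrite -[RHS]w1 big_tuple; apply: eq_bigr => i _; exact: mnm_of_tuples_x.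
  rewrite -[RHS]w2 big_tuple; apply: eq_bigr => i _; exact: mnm_of_tuples_y.
have lex i : (m (lshift n i) <= a)%N by rewrite -mx /degx (bigD1 i) //= leq_addr.
have lez i : (m (rshift n i) <= b)%N by rewrite -mz /degz (bigD1 i) //= leq_addr.
exists ([tuple inord (m (lshift n i)) : 'I_a.+1 | i < n],
        [tuple inord (m (rshift n i)) : 'I_b.+1 | i < n]).
  rewrite mem_enum !inE; apply/andP; split; apply/eqP.
    by rewrite -[RHS]mx big_tuple; apply: eq_bigr => i _; rewrite tnth_mktuple inordK // ltnS.
  by rewrite -[RHS]mz big_tuple; apply: eq_bigr => i _; rewrite tnth_mktuple inordK // ltnS.
apply: mnm_xyP => i; rewrite ?mnm_of_tuples_x ?mnm_of_tuples_y tnth_mktuple inordK //.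
all: by rewrite ltnS.
Qed.

Lemma size_bimonomials a b : (0 < n)%N ->
  size (bimonomials a b) = ('C(n + a - 1, a) * 'C(n + b - 1, b))%N.
Proof.
move=> n0; rewrite size_map -cardE cardsX; case: n n0 => // n' _.
have e k : (n'.+1 + k - 1 = n' + k)%N by lia.
rewrite !card_ord_partitions !e -[in RHS]bin_sub ?leq_addl // addnK.
by rewrite -['C(n' + b, b)]bin_sub ?leq_addl // addnK.
Qed.

Lemma bihom_subset (K : fieldType) a b (p : {mpoly K[n + n]}) :
  bihom a b p -> {subset msupp p <= bimonomials a b}.
Proof.
by move/bihomP => h m /h[ex ez]; rewrite mem_bimonomials ex ez !eqxx.
Qed.

Lemma poly_of_row_bihom (K : fieldType) a b (u : 'rV[K]_(size (bimonomials a b))) :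
  bihom a b (poly_of_row u).
Proof.
rewrite /bihom /poly_of_row linear_sum; apply: eq_bigr => k _ /=.
rewrite linearZ /= bipartX; have := mem_tnth k (in_tuple (bimonomials a b)).
by rewrite /= mem_bimonomials => ->.
Qed.

End Bimonomials.

(** * Local cohomology of the hypersurface *)

Section HypersurfaceCohomology.
Variables (K : fieldType) (charK : [pchar K] =i pred0) (n : nat).
Variables (l : 'I_n -> K) (r : nat).
Local Notation g := (f_lambda l ^+ r).
Local Notation M := (hypersurface g).
Local Notation y := (@yvar K n).
Local Notation E := (iter r (raisex l)).

Definition num_class (p : bipoly K n) (k : nat) : local_cohomology M y n :=
  top_class y (modproj (principal g) (p : (bipoly K n)^o)) k.

Lemma num_classP (q p p' : bipoly K n) k :
  num_class (q * p + p') k = q *: num_class p k + num_class p' k.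
Proof. by rewrite /num_class modprojD (modprojZ _ q) top_classP. Qed.

Lemma cech_den_yE : cech_den y [set: 'I_n] = \prod_j 'X_(rshift n j) :> {mpoly K[n + n]}.
Proof. by apply: eq_bigl => i; rewrite inE. Qed.

Lemma num_class_shift (p : bipoly K n) k t :
  num_class (cech_den y [set: 'I_n] ^+ t * p) (k + t) = num_class p k.
Proof. by rewrite /num_class (modprojZ _ (_ ^+ t)) top_class_scale_den. Qed.

Lemma inverse_of_num_g k (p : bipoly K n) :
  inverse_of_num k (g * p : bipoly K n) = E (inverse_of_num k p).
Proof. exact: inverse_of_num_linear_form. Qed.

(** A vanishing class has a numerator in the ideal of [g] and of high powers
    of the [y_i]; [inverse_of_num] kills the latter and turns [g] into [E]. *)
Lemma num_class_eq0 (p : bipoly K n) k : num_class p k = 0 ->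
  exists w, inverse_of_num k p = E w.
Proof.
move/top_class_eq0 => [t [q]].
have [q' qE] := choice (fun i => modproj_surj (q i)).
have -> : \sum_i y i ^+ (t + k) *: q i
    = \sum_i modproj (principal g) (y i ^+ (t + k) *: q' i).
  by apply: eq_bigr => i _; rewrite qE modprojZ.
rewrite -modprojZ -modproj_sum => /eqP.
rewrite modproj_eq => /asboolP[w /eqP]; rewrite subr_eq => /eqP Ep.
exists (inverse_of_num (t + k) w).
rewrite -(inverse_of_num_shift _ t) -cech_den_yE addnC.
rewrite [X in inverse_of_num _ X]Ep linearD /= inverse_of_num_g.
rewrite linear_sum big1 ?addr0 // => i _; exact: inverse_of_num_power.
Qed.

(** Conversely, for a large denominator the inverse polynomial [w] has a
    numerator [v], and [p] differs from [g * v] by a numerator that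
    [inverse_of_num] kills. Bihomogeneity of [w] only serves to bound its
    exponents. *)
Lemma num_class_image (p : bipoly K n) k a b w : bihom a b w ->
  inverse_of_num k p = E w -> num_class p k = 0.
Proof.
move=> hw pE; rewrite -(num_class_shift p k b.+1).
set Y := cech_den y _; set v := num_of_inverse (k + b.+1) w.
have [q qE] : exists q : 'I_n -> {mpoly K[n + n]},
    (Y ^+ b.+1 * p - g * (v : bipoly K n) : bipoly K n)
    = \sum_j 'X_(rshift n j) ^+ (k + b.+1) * q j.
  apply: inverse_of_num_eq0 => //; rewrite linearB /= inverse_of_num_g.
  rewrite /v (inverse_of_numK charK hw); last by lia.
  by rewrite /Y cech_den_yE inverse_of_num_shift pE subrr.
have -> : Y ^+ b.+1 * p = 1 * (g * (v : bipoly K n))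
    + \sum_j y j ^+ (k + b.+1) * (q j : bipoly K n).
  by rewrite mul1r -qE addrC subrK.
rewrite num_classP scale1r [X in X + _](_ : _ = 0); last first.
  rewrite /num_class (iffRL (modproj_eq0 _ _)) ?top_class0 //.
  by apply/asboolP; exists v.
rewrite add0r /num_class modproj_sum.
rewrite top_class_sum big1 // => i _.
by rewrite (modprojZ _ (_ ^+ _)) top_class_boundary.
Qed.

Lemma num_class_eq (p p' : bipoly K n) k k' :
  inverse_of_num k p = inverse_of_num k' p' -> num_class p k = num_class p' k'.
Proof.
move=> e; apply/eqP; rewrite -subr_eq0; apply/eqP.
rewrite -(num_class_shift p k k') -(num_class_shift p' k' k) addnC addrC.
rewrite -scaleN1r -num_classP.
apply: (@num_class_image _ _ 0 0 0); first by rewrite /bihom linear0.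
rewrite iter_raisex0 mulN1r linearD linearN /= cech_den_yE.
by rewrite inverse_of_num_shift addnC inverse_of_num_shift e addNr.
Qed.

Variables (i c : nat).
Hypothesis n_gt0 : (0 < n)%N.
Local Notation j := (- (n + c)%N%:Z).
Local Notation L := (bimonomials n i c).

Lemma sum_deg_y k : (\sum_(s < n) ((0, 1) : int * int)) *+ k = (0, (n * k)%N%:Z).
Proof.
rewrite sumr_const card_ord -mulrnA; elim: (n * k)%N => [|m IH] //.
by rewrite mulrS IH; congr pair; rewrite /= -natz; lia.
Qed.

Lemma hypersurface_gr0 d : @hypersurface_gr K n g d 0.
Proof.
exists 0; split; first by move=> m; rewrite msupp0.
by rewrite modproj0.
Qed.

(** The exponents of a polynomial of degree [c] in [z] are less than [c.+1], so
    this denominator suffices. *)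
Definition class_of_row (u : 'rV[K]_(size L)) : local_cohomology M y n :=
  num_class (num_of_inverse c.+1 (poly_of_row u)) c.+1.

Lemma inverse_of_class_of_row (u : 'rV[K]_(size L)) :
  inverse_of_num c.+1 (num_of_inverse c.+1 (poly_of_row u))
  = poly_of_row u :> {mpoly K[n + n]}.
Proof. by apply: (inverse_of_numK charK (poly_of_row_bihom u)). Qed.

Lemma class_of_rowP a u v :
  class_of_row (a *: u + v) = a%:A *: class_of_row u + class_of_row v.
Proof.
rewrite /class_of_row -num_classP; congr num_class.
by rewrite !linearP /= mulr_algl.
Qed.

(** A numerator over the [k]-th power has degree [j + n * k] in [y] when the
    fraction has degree [j = - (n + c)]. Since the exponents of [y] and [z] add
    up to [k - 1], its inverse polynomial has degree [c] in [z]. *)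
Lemma lc_componentE (h : local_cohomology M y n) :
  lc_component i%:Z j h <-> exists u, h = class_of_row u.
Proof.
rewrite /lc_component top_class_gr; last exact: hypersurface_gr0.
split=> [[_ [k [[p [pgr ->]] ->]]]|[u ->]].
  move: pgr; rewrite sum_deg_y => pgr.
  have hp : bihom i c (inverse_of_num k (p : {mpoly K[n + n]})).
    case: (lerP 0 (j + (n * k)%N%:Z)) => [jk|jk].
      have k0 : (0 < k)%N by case: k {pgr} jk => // ; lia.
      pose e := (n * k - (n + c))%N.
      apply: (@bihom_inverse_of_num _ _ _ _ e); last first.
        by case: k k0 jk @e {pgr} => // k _; rewrite mulnS /=; lia.
      apply/bihomP => m /pgr[ex ez]; split; first by move: ex; rewrite /= -/(degx m); lia.
      by move: ez; rewrite -/(degz m) /e; lia.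
    (* No monomial has the negative degree [j + n * k] in [y]. *)
    suff -> : p = 0 by rewrite linear0 /bihom linear0.
    apply/eqP; rewrite -msupp_eq0; case pE: (msupp p) => [//|m s].
    have /pgr[_] : m \in msupp p by rewrite pE mem_head.
    by lia.
  exists (row_of_poly L (inverse_of_num k p)); apply: num_class_eq.
  by rewrite inverse_of_class_of_row (row_of_polyK (bimonomials_uniq _ _ _) (bihom_subset hp)).
exists (modproj (principal g) (num_of_inverse c.+1 (poly_of_row u) : bipoly K n)), c.+1.
split=> //; rewrite sum_deg_y.
exists (num_of_inverse c.+1 (poly_of_row u)); split=> // m.
move/bihomP: (bihom_num_of_inverse c.+1 (poly_of_row_bihom u)) => hv /hv[ex ez].
rewrite /mnm_bideg; congr pair; rewrite /=; first by rewrite -/(degx m) ex addr0.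
rewrite -/(degz m) ez mulnS /=; have : (c <= n * c)%N by rewrite leq_pmull.
lia.
Qed.

Lemma class_of_row_eq0 u : class_of_row u = 0 ->
  exists w, poly_of_row u = E w.
Proof.
by move/num_class_eq0 => [w]; rewrite inverse_of_class_of_row; exists w.
Qed.

Lemma class_of_row_image u a b w : bihom a b w -> poly_of_row u = E w ->
  class_of_row u = 0.
Proof.
by move=> hw uE; apply: (num_class_image hw); rewrite inverse_of_class_of_row.
Qed.

(** Here [E^r] raises the degree in [x] above [i], so nothing is divided
    out. *)
Lemma has_dim_lt : (i < r)%N ->
  has_dim (@lc_component K n g n i%:Z j) (size L).
Proof.
move=> ir; have := @has_dim_image K (bipoly K n) _ (@lc_component K n g n i%:Z j) _ 1
  (0 : 'M_(1, size L)) class_of_row class_of_rowP.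
rewrite mxrank0 subn0; apply; last exact: lc_componentE.
move=> u; split=> [/class_of_row_eq0[w uw]|/submx0null ->]; last first.
  apply: (@class_of_row_image _ 0 0 0); first by rewrite /bihom linear0.
  by rewrite iter_raisex0 linear0.
have : poly_of_row u = 0.
  by rewrite -(poly_of_row_bihom u) uw bipart_iter_raisex_lt.
move/(congr1 (row_of_poly L)).
by rewrite poly_of_rowK ?bimonomials_uniq // linear0 => ->; apply: sub0mx.
Qed.

Local Notation L' := (bimonomials n (i - r) (c + r)).

Definition raise_mx : 'M[K]_(size L', size L) :=
  \matrix_k row_of_poly L (E 'X_[tnth (in_tuple L') k]).

Hypothesis ri : (r <= i)%N.

Lemma bihom_E w : bihom (i - r) (c + r) w -> bihom i c (E w).
Proof. by move/bihom_iter_raisex; rewrite subnK. Qed.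

Lemma raise_mxE (u : 'rV[K]_(size L')) : poly_of_row (u *m raise_mx) = E (poly_of_row u).
Proof.
have Ew := bihom_E (poly_of_row_bihom u).
rewrite -[RHS](row_of_polyK (bimonomials_uniq _ _ _) (bihom_subset Ew)); congr poly_of_row.
have E_sum (s : seq 'I_(size L')) (F : 'I_(size L') -> {mpoly K[n + n]}) :
    E (\sum_(k <- s) F k) = \sum_(k <- s) E (F k).
  elim: s => [|k s IH]; first by rewrite !big_nil iter_raisex0.
  by rewrite !big_cons -[F k in LHS]scale1r iter_raisexP scale1r IH.
rewrite mulmx_sum_row E_sum linear_sum; apply: eq_bigr => k _ /=.
rewrite rowK -[X in _ = row_of_poly _ (E X)]addr0 iter_raisexP iter_raisex0 addr0.
by rewrite linearZ.
Qed.

(** The image of [E^r] in bidegree [(i, c)] is the row space of [raise_mx],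
    whose rows are independent by [iter_raisex_inj]. *)
Lemma has_dim_ge : (forall k, l k != 0) -> (i <= c + r)%N ->
  has_dim (@lc_component K n g n i%:Z j) (size L - size L') /\ (size L' <= size L)%N.
Proof.
move=> l0 ic.
have rk : \rank raise_mx = size L'.
  apply/eqP; apply: inj_row_free => u u0.
  have := raise_mxE u; rewrite u0 linear0 => /esym e.
  have := iter_raisex_inj l0 charK (poly_of_row_bihom u) _ e.
  rewrite subnK // => /(_ ic) /(congr1 (row_of_poly L')).
  by rewrite poly_of_rowK ?bimonomials_uniq // linear0.
split; last by rewrite -rk rank_leq_col.
rewrite -rk; apply: (has_dim_image class_of_rowP); last exact: lc_componentE.
move=> u; split=> [/class_of_row_eq0[w uw]|/submxP[w ->]]; last first.
  by apply: (class_of_row_image (poly_of_row_bihom w)); rewrite raise_mxE.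
apply/submxP; exists (row_of_poly L' (bipart (i - r) (c + r) w)).
apply: (can_inj (poly_of_rowK (bimonomials_uniq _ _ _))).
(* Only the part of bidegree [(i - r, c + r)] of a preimage contributes. *)
have hw : bihom (i - r) (c + r) (bipart (i - r) (c + r) w).
  by apply/mpolyP => m; rewrite !mcoeff_bipart; case: (_ && _).
rewrite raise_mxE (row_of_polyK (bimonomials_uniq _ _ _) (bihom_subset hw)).
rewrite -bipart_iter_raisex subnK //.
by rewrite -uw (poly_of_row_bihom u).
Qed.

End HypersurfaceCohomology.

(** * The theorem *)

(** It is the complement of the hypersurface [l_1 ... l_n = 0]. *)
Lemma zariski_open_coordinates (K : fieldType) (n : nat) :
  zariski_open (fun l : 'I_n -> K => forall i, l i != 0).
Proof.
exists (fun p => p = \prod_i 'X_i) => l.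
have evE : (\prod_i 'X_i : {mpoly K[n]}).@[l] = \prod_i l i.
  by rewrite rmorph_prod; apply: eq_bigr => i _; rewrite /= mevalXU.
split=> [l0|[_ -> ]]; last first.
  by rewrite evE => /prodf_neq0 l0 i; apply: l0.
by exists (\prod_i 'X_i) => //; rewrite evE; apply/prodf_neq0 => i _; apply: l0.
Qed.

Theorem corollary4p3 (K : fieldType) (charK : [pchar K] =i pred0)
    (n : nat) (hn : (2 <= n)%N) (r : nat) (hr : (1 <= r)%N) :
  exists V : ('I_n -> K) -> Prop,
    zariski_open V /\ (exists l, V l) /\
    forall l, V l -> forall j : int, j <= - n%:Z -> forall i : nat,
      ((i < r)%N ->
        has_dim (@lc_component K n (f_lambda l ^+ r) n i%:Z j)
          ('C(n + i - 1, i) * 'C(`|(- j - 1)%R|, `|(- n%:Z - j)%R|))%N) /\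
      ((r <= i)%N -> i%:Z <= - n%:Z - j + r%:Z - 1 ->
        exists2 d : nat,
          has_dim (@lc_component K n (f_lambda l ^+ r) n i%:Z j) d &
          d%:Z = ('C(n + i - 1, i) * 'C(`|(- j - 1)%R|, `|(- n%:Z - j)%R|))%N%:Z
               - ('C(n + i - r - 1, i - r)
                  * 'C(`|(- j + r%:Z - 1)%R|, `|(- n%:Z - j + r%:Z)%R|))%N%:Z).
Proof.
exists (fun l => forall i, l i != 0); split; first exact: zariski_open_coordinates.
split; first by exists (fun=> 1) => i; apply: oner_neq0.
move=> l l0 j jn i; have n0 : (0 < n)%N by apply: ltnW.
(* [c] is the degree in [z] of the component. *)
have [c jE] : exists c : nat, j = - (n + c)%N%:Z by exists `|(- n%:Z - j)%R|%N; lia.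
have -> : `|(- j - 1)%R|%N = (n + c - 1)%N by lia.
have -> : `|(- n%:Z - j)%R|%N = c by lia.
have -> : `|(- j + r%:Z - 1)%R|%N = (n + (c + r) - 1)%N by lia.
have -> : `|(- n%:Z - j + r%:Z)%R|%N = (c + r)%N by lia.
rewrite -size_bimonomials // {}jE; split=> [ir|ri ic].
  exact: has_dim_lt.
have ic' : (i <= c + r)%N by lia.
have [dimH le] := has_dim_ge charK n0 ri l0 ic'.
exists (size (bimonomials n i c) - size (bimonomials n (i - r) (c + r)))%N => //.
have -> : (n + i - r - 1 = n + (i - r) - 1)%N by lia.
by rewrite -size_bimonomials // -subzn.
Qed.
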